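(* Let $T(\mathbb{Z})$ be the Takasaki quandle of the group $\mathbb{Z}$. Then the following statements hold: (1) The Cayley graph $\Gamma_{T(\mathbb{Z})}$ is symmetric. (2) The graph $\Gamma_{T(\mathbb{Z})}$ has two connected components, each isomorphic to the complete directed graph on a countably infinite vertex set, and for any $a,c\in T(\mathbb{Z})$ there is an edge from $a$ to $c$ if and only if $c+a\equiv 0 \pmod 2$.
   Context: A quandle is a set $Q$ with a binary operation $\rhd$ such that for all $x,y,z\in Q$: (1) $x\rhd x=x$; (2) for each $y$ the map $R_y(x)=x\rhd y$ is a bijection $Q\to Q$; (3) $(x\rhd y)\rhd z=(x\rhd z)\rhd(y\rhd z)$. The Takasaki quandle of an abelian group $G$ is the set $G$ with operation $x\rhd y=yx^{-1}y$; thus $T(\mathbb{Z})$ is the set $\mathbb{Z}$ with operation $a\rhd b=2b-a$. All graphs are directed graphs, with loops allowed and without multiple edges, so the edge set is a subset of $V\times V$. The (right) Cayley graph $\Gamma_Q$ of a quandle $Q$ is the directed graph with vertex set $Q$ and edge set $\{(x,x\rhd y): x,y\in Q\}$. A directed graph is symmetric if whenever $(a,c)$ is an edge, so is $(c,a)$. It is connected if for every ordered pair of vertices $(u,v)$ there is a directed path from $u$ to $v$; the connected components are the maximal connected induced subgraphs. A directed graph is complete if for any two distinct vertices $a,b$ both edges $(a,b)$ and $(b,a)$ are present and there is exactly one loop at each vertex. *)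

(* Defs.v *)
From mathcomp Require Import all_boot all_order all_algebra.
From mathcomp Require Import all_classical.

Set Implicit Arguments.
Unset Strict Implicit.
Unset Printing Implicit Defensive.

Import GRing.Theory.
Local Open Scope classical_set_scope.
Local Open Scope ring_scope.

Record quandle := Quandle {
  quandle_sort :> Type;
  qop : quandle_sort -> quandle_sort -> quandle_sort;
  qop_idem : forall x, qop x x = x;
  qop_bij : forall y, bijective (fun x => qop x y);
  qop_distr : forall x y z, qop (qop x y) z = qop (qop x z) (qop y z)
}.

(* The operation y x^-1 y, in additive notation. *)
Definition takasaki_op (G : zmodType) (x y : G) : G := y - x + y.

Lemma takasaki_idem (G : zmodType) (x : G) : takasaki_op x x = x.
Proof. by rewrite /takasaki_op subrr add0r. Qed.

Lemma takasaki_bij (G : zmodType) (y : G) :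
  bijective (fun x : G => takasaki_op x y).
Proof.
by exists (fun x => takasaki_op x y) => x;
  rewrite /takasaki_op opprD opprB -addrA subrK addrC subrK.
Qed.

Lemma takasaki_distr (G : zmodType) (x y z : G) :
  takasaki_op (takasaki_op x y) z
  = takasaki_op (takasaki_op x z) (takasaki_op y z).
Proof.
rewrite /takasaki_op opprD opprB [in RHS]opprD opprB.
rewrite [X in _ = X + _](_ : _ = x - y).
  by rewrite !addrA [z + x]addrC [x + z - y]addrAC.
by rewrite addrC [z - y + z]addrC addrA subrK addrA subrK.
Qed.

Definition takasaki (G : zmodType) : quandle :=
  Quandle (@takasaki_idem G) (@takasaki_bij G) (@takasaki_distr G).

Record digraph := Digraph {
  vertex :> Type;
  edges : set (vertex * vertex)
}.

Definition symmetric_digraph (G : digraph) : Prop :=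
  forall a c : G, edges (a, c) -> edges (c, a).

Definition connected_digraph (G : digraph) : Prop :=
  forall u v : G, exists p : seq G,
    path (fun a b => (a, b) \in @edges G) u p /\ last u p = v.

(* A loop is an edge (a, a), and it cannot have multiplicity. *)
Definition complete_digraph (G : digraph) : Prop :=
  (forall a b : G, a <> b -> edges (a, b) /\ edges (b, a)) /\
  (forall a : G, edges (a, a)).

Definition induced_subgraph (G : digraph) (C : set G) : digraph :=
  @Digraph C [set e : C * C | edges (val e.1, val e.2)].

Definition is_component (G : digraph) (C : set G) : Prop :=
  connected_digraph (induced_subgraph C) /\
  forall D : set G,
    C `<=` D -> connected_digraph (induced_subgraph D) -> D = C.

Definition digraph_isomorphic (G H : digraph) : Prop :=
  exists2 f : G -> H, bijective f &
    forall a b : G, edges (a, b) <-> edges (f a, f b).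

Definition cayley_graph (Q : quandle) : digraph :=
  @Digraph Q [set e | exists x y : Q, e = (x, qop x y)].

(* Main.v *)
Require Import Defs.
From mathcomp Require Import all_boot all_order all_algebra.
From mathcomp Require Import all_classical.
From mathcomp Require Import zify.

(** An edge goes from [a] to [2 b - a], so [(a, c)] is an edge iff [a + c] is
    even. Hence the edge relation is an equivalence relation with two infinite
    classes, and the components of a graph whose edge relation is an equivalence
    are its classes, which induce complete graphs. *)

Local Open Scope classical_set_scope.
Local Open Scope card_scope.
Local Open Scope ring_scope.

Section EquivalenceGraph.

Variable G : digraph.
Hypothesis edge_refl : forall a : G, edges (a, a).
Hypothesis edge_sym : symmetric_digraph G.
Hypothesis edge_trans :
  forall a b c : G, edges (a, b) -> edges (b, c) -> edges (a, c).

Definition edge_class (a : G) : set G := [set b | edges (a, b)].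

Lemma edge_class_eq (a b : G) : edges (a, b) -> edge_class a = edge_class b.
Proof.
move=> ab; apply/seteqP; split=> c /=; last exact: edge_trans.
by apply: edge_trans; apply: edge_sym.
Qed.

Lemma edge_class_edge (a b c : G) :
  edge_class a b -> edge_class a c -> edges (b, c).
Proof. by move=> /edge_sym ba; apply: edge_trans. Qed.

(** By transitivity a path collapses to a single edge; the empty path is covered by reflexivity. *)
Lemma connected_edge (C : set G) (a b : G) :
  connected_digraph (induced_subgraph C) -> C a -> C b -> edges (a, b).
Proof.
move=> Cconn Ca Cb.
pose u : induced_subgraph C := exist _ a (mem_set Ca).
have [p []] := Cconn u (exist _ b (mem_set Cb)).
(* The start vertex is generalised, since the induction on the path moves it. *)
rewrite -[a]/(val u); move: u.
elim: p => [|w p IHp] u /=; first by move=> _ ->.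
by move=> /andP[/set_mem uw pw] /(IHp _ pw); apply: edge_trans.
Qed.

Lemma edge_class_connected (a : G) :
  connected_digraph (induced_subgraph (edge_class a)).
Proof.
move=> u v; exists [:: v]; split=> //=.
rewrite andbT; apply: mem_set => /=.
by apply: (@edge_class_edge a); apply: set_valP.
Qed.

(** For maximality: a connected [D] containing the class contains [a], so each of its points is
    joined to [a] by an edge. *)
Lemma edge_class_component (a : G) : is_component (edge_class a).
Proof.
split=> [|D aD Dconn]; first exact: edge_class_connected.
apply/seteqP; split=> // b Db.
by apply: (connected_edge D) => //; apply/aD/edge_refl.
Qed.

(** A nonempty component lies in the class of any of its points, and that class is connected, so
    maximality forces equality. The empty set is vacuously connected; the vertex [x] supplies a
    class containing it, to which maximality applies as well. *)
Lemma component_edge_class (x : G) (C : set G) :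
  is_component C -> exists a, C = edge_class a.
Proof.
move=> [Cconn Cmax].
have [C0|/set0P[a Ca]] := eqVneq C set0; last first.
  exists a; apply/esym/Cmax; last exact: edge_class_connected.
  by move=> b Cb; apply: (connected_edge C).
exists x; apply/esym/Cmax; last exact: edge_class_connected.
by rewrite C0.
Qed.

Lemma edge_class_complete (a : G) :
  complete_digraph (induced_subgraph (edge_class a)).
Proof.
have ae (u v : induced_subgraph (edge_class a)) : edges (u, v).
  by apply: (@edge_class_edge a); apply: set_valP.
by split=> [u v _|u]; [split|]; apply: ae.
Qed.

End EquivalenceGraph.

Lemma digraph_isomorphic_refl (G : digraph) : digraph_isomorphic G G.
Proof. by exists id; [exists id|]. Qed.

Lemma takasaki_int_edge (a c : int) :
  @edges (cayley_graph (takasaki int)) (a, c) <-> (c + a = 0 %[mod 2])%Z.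
Proof.
split=> [[x [y [-> ->]]]|ac] /=; first by rewrite /takasaki_op; lia.
(* Solving [2 y - a = c] for [y]; the division is exact by parity. *)
exists a, ((c + a) %/ 2)%Z; congr (_, _) => /=.
by rewrite /takasaki_op; lia.
Qed.

Theorem proposition3p3 :
  symmetric_digraph (cayley_graph (takasaki int)) /\
  [/\ [set C | @is_component (cayley_graph (takasaki int)) C] #= `I_2,
      forall C, @is_component (cayley_graph (takasaki int)) C ->
        exists K : digraph,
          [/\ complete_digraph K, [set: K] #= [set: nat] &
              digraph_isomorphic (induced_subgraph C) K] &
      forall a c : int,
        @edges (cayley_graph (takasaki int)) (a, c)
        <-> (c + a = 0 %[mod 2])%Z].
Proof.
set G := cayley_graph _.
have Grefl (a : G) : edges (a, a) by apply/takasaki_int_edge; lia.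
have Gsym : symmetric_digraph G.
  by move=> a c /takasaki_int_edge ac; apply/takasaki_int_edge; lia.
have Gtrans (a b c : G) : edges (a, b) -> edges (b, c) -> edges (a, c).
  move=> /takasaki_int_edge ab /takasaki_int_edge bc.
  by apply/takasaki_int_edge; lia.
split=> //; split; last exact: takasaki_int_edge.
(* The components are the classes of 0 and 1, the class of [a] being that of its residue mod 2. *)
- pose f (n : nat) : set G := edge_class G n%:Z.
  rewrite (_ : [set C | _] = f @` `I_2); last first.
    apply/seteqP; split=> [C /= | _ [n _ <-]]; last exact: edge_class_component.
    move=> /(component_edge_class G Grefl Gsym Gtrans (0 : int))[a ->].
    exists `|(a %% 2)%Z|%N; first by rewrite /=; lia.
    by rewrite /f; apply: (edge_class_eq G Gsym Gtrans); apply/takasaki_int_edge; lia.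
  apply: inj_card_eq => m n /set_mem /= m2 /set_mem /= n2 fmn.
  (* Equal classes give [m] and [n] the same parity, and both are below 2. *)
  have : f m n%:Z by rewrite fmn; apply: Grefl.
  by move=> /takasaki_int_edge; lia.
- move=> C /(component_edge_class G Grefl Gsym Gtrans (0 : int))[a ->].
  exists (induced_subgraph (edge_class G a)); split.
  + exact: edge_class_complete.
  + apply: card_eq_trans (card_setT _) _; apply: eq_card_nat.
      exact: (@countableP int).
    pose f (n : nat) : int := a + 2 * n%:Z.
    have fsub : range f `<=` edge_class G a.
      by move=> _ [n _ <-]; apply/takasaki_int_edge; rewrite /f; lia.
    apply: (sub_infinite_set fsub).
    have fcard : range f #= [set: nat].
      by apply: inj_card_eq => m n _ _; rewrite /f; lia.
    by rewrite (eq_finite_set fcard); apply: infinite_nat.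
  + exact: digraph_isomorphic_refl.
Qed.
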